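(* Let $G$ be a finite simple graph and let $X$ be a maximal (with respect to inclusion) critical independent set of $G$. Then $\operatorname{diadem}(G) \subseteq (X \cup N(X)) \setminus N(\ker(G))$.
   Context: For $A \subseteq V(G)$, $N(A)$ is the set of vertices adjacent to some vertex of $A$; $d(A)=|A|-|N(A)|$; $d_c(G)=\max\{d(A): A \subseteq V(G)\}$; a set $A$ is critical if $d(A)=d_c(G)$; $\ker(G)$ is the intersection of all critical sets of $G$; $\operatorname{diadem}(G)$ is the union of all critical independent sets of $G$. *)

(* Defs.v *)
From mathcomp Require Import all_boot all_order all_algebra.

Set Implicit Arguments.
Unset Strict Implicit.
Unset Printing Implicit Defensive.

Import Order.TTheory GRing.Theory Num.Theory.

(* A finite simple graph is a symmetric irreflexive relation [e] on a finite
   type of vertices; the definitions below take [e] as first argument. *)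

Definition neighborhood (T : finType) (e : rel T) (A : {set T}) : {set T} :=
  [set y | [exists x in A, e x y]].

Definition independent (T : finType) (e : rel T) (A : {set T}) : bool :=
  [forall x in A, forall y in A, ~~ e x y].

(* Integer-valued, since |A| - |N(A)| may be negative. *)
Definition difference (T : finType) (e : rel T) (A : {set T}) : int :=
  (#|A|%:Z - #|neighborhood e A|%:Z)%R.

(* The default value of the iterated maximum is itself one of the d(A), so this
   is exactly max {d(A) : A \subset V(G)}. *)
Definition critical_difference (T : finType) (e : rel T) : int :=
  \big[Num.max/difference e set0]_(A : {set T}) difference e A.

Definition critical (T : finType) (e : rel T) (A : {set T}) : bool :=
  difference e A == critical_difference e.

Definition critical_independent (T : finType) (e : rel T) (A : {set T}) : bool :=
  critical e A && independent e A.

Definition ker (T : finType) (e : rel T) : {set T} :=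
  \bigcap_(A : {set T} | critical e A) A.

Definition diadem (T : finType) (e : rel T) : {set T} :=
  \bigcup_(A : {set T} | critical_independent e A) A.

(* Main.v *)
Require Import Defs.
From mathcomp Require Import all_boot all_order all_algebra.
From mathcomp Require Import zify.

(** A critical independent set S contains ker(G), hence misses N(ker(G)).
    For S \subset X :|: N(X), it is enough that W = (X :|: S) :\: N(X), which
    is independent and contains X, is critical.  The function d is
    supermodular, so X :|: S is critical.  Passing from X :|: S to W removes
    S :&: N(X), while all of X :&: N(S) leaves the neighborhood; and
    |S :&: N(X)| <= |X :&: N(S)|, since otherwise X :\: N(S) would have larger
    difference than X. *)

Set Implicit Arguments.
Unset Strict Implicit.
Unset Printing Implicit Defensive.

Import Order.TTheory GRing.Theory Num.Theory.

Section Critical.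

Variables (T : finType) (e : rel T).
Implicit Types A B S X : {set T}.

Local Notation N := (neighborhood e).
Local Notation d := (difference e).

Lemma neighborhoodP A y : reflect (exists2 x, x \in A & e x y) (y \in N A).
Proof. by rewrite inE; apply: (iffP exists_inP). Qed.

Lemma neighborhoodS A B : A \subset B -> N A \subset N B.
Proof.
move=> /subsetP sAB; apply/subsetP => y /neighborhoodP[x xA exy].
by apply/neighborhoodP; exists x; first exact: sAB.
Qed.

Lemma neighborhoodU A B : N (A :|: B) = N A :|: N B.
Proof.
apply/eqP; rewrite eqEsubset subUset !neighborhoodS ?subsetUl ?subsetUr //.
rewrite !andbT; apply/subsetP => y /neighborhoodP[x].
by rewrite !in_setU => /orP[] xAB exy; apply/orP; [left|right];
   apply/neighborhoodP; exists x.
Qed.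

Lemma independentP A :
  reflect {in A &, forall x y, ~~ e x y} (independent e A).
Proof.
apply: (iffP forall_inP) => [indA x y xA yA | indA x xA].
  exact: (forall_inP (indA x xA)).
by apply/forall_inP => y yA; exact: indA.
Qed.

Lemma independent_disjoint_neighborhood A :
  independent e A -> A :&: N A = set0.
Proof.
move=> /independentP indA; apply/setP => y; rewrite in_setI in_set0.
apply/andP => -[yA /neighborhoodP[x xA]].
by apply/negP; exact: indA.
Qed.

Lemma difference_le_critical A : (d A <= critical_difference e)%R.
Proof. exact: (le_bigmax_cond _ d). Qed.

Lemma critical_le A B : critical e A -> (d A <= d B)%R -> critical e B.
Proof.
move=> /eqP dA leAB; rewrite /critical eq_le difference_le_critical /=.
by rewrite -dA.
Qed.

(** Cardinality is modular, while [N] commutes with unions and sends [A :&: B] into [N A :&: N B],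
    so the size of the neighborhood is submodular. *)
Lemma difference_supermodular A B :
  (d A + d B <= d (A :|: B) + d (A :&: B))%R.
Proof.
have subI : N (A :&: B) \subset N A :&: N B.
  by rewrite subsetI !neighborhoodS ?subsetIl ?subsetIr.
have := subset_leq_card subI.
have := cardsUI A B; have := cardsUI (N A) (N B).
rewrite /difference neighborhoodU; lia.
Qed.

(** As [d (A :&: B)] is at most the maximum [d B], supermodularity leaves at least [d A] for the
    union. *)
Lemma criticalU A B : critical e A -> critical e B -> critical e (A :|: B).
Proof.
move=> cA /eqP dB; apply: (critical_le cA).
have := difference_supermodular A B.
have := difference_le_critical (A :&: B); lia.
Qed.

Lemma ker_sub_critical A : critical e A -> ker e \subset A.
Proof. by move=> cA; apply: bigcap_inf. Qed.

Hypothesis e_sym : symmetric e.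

(** By symmetry, a vertex with a neighbor in [B] lies in [N B], so deleting [N B] from [A] cuts
    every edge to [B]. *)
Lemma neighborhood_setDN A B : N (A :\: N B) \subset N A :\: B.
Proof.
rewrite subsetD neighborhoodS ?subsetDl //= disjoint_subset.
apply/subsetP => y /neighborhoodP[x]; rewrite !inE => /andP[xNB _] exy.
apply: contra xNB => yB; apply/exists_inP; exists y => //.
by rewrite e_sym.
Qed.

(** Passing from [A] to [A :\: N B] costs [#|A :&: N B|] vertices and frees at least [#|B :&: N A|]
    neighbors; the maximality of [d A] forbids a net gain. *)
Lemma critical_exchange A B :
  critical e A -> #|B :&: N A| <= #|A :&: N B|.
Proof.
move=> /eqP dA.
have := difference_le_critical (A :\: N B); rewrite -dA /difference.
have := subset_leq_card (neighborhood_setDN A B).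
have := cardsID (N B) A; have := cardsID B (N A).
rewrite [N A :&: B]setIC; lia.
Qed.

Lemma critical_independent_augment X S :
    critical_independent e X -> critical_independent e S ->
  critical_independent e ((X :|: S) :\: N X).
Proof.
move=> /andP[cX iX] /andP[cS iS].
have XNX := independent_disjoint_neighborhood iX.
apply/andP; split.
  apply: (critical_le (criticalU cX cS)).
  have := critical_exchange S cX.
  have := subset_leq_card (neighborhood_setDN (X :|: S) X).
  have := cardsID X (N (X :|: S)); have := cardsID (N X) (X :|: S).
  (* Since [X] misses [N X], only [S] contributes to the removed vertices, and only [N S] to the
     neighbors lost in [X]. *)
  rewrite setIUl XNX set0U {1}neighborhoodU setIUl [N X :&: X]setIC XNX set0U.
  rewrite [N S :&: X]setIC /difference; lia.
(* The new set avoids [N X], so none of its edges can have an end in [X]; a pair outside [X] lies in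
   [S]. *)
have noX x y : x \in X -> y \notin N X -> ~~ e x y.
  by move=> xX; apply: contra => exy; apply/neighborhoodP; exists x.
apply/independentP => x y; rewrite !in_setD !in_setU.
move=> /andP[xNX /orP[xX|xS]]; first by case/andP=> ? _; exact: noX.
move=> /andP[yNX /orP[yX|yS]]; first by rewrite e_sym noX.
exact: (independentP _ iS).
Qed.

End Critical.

Theorem theorem3p2 (T : finType) (e : rel T)
    (e_sym : symmetric e) (e_irr : irreflexive e) (X : {set T})
    (X_max : maxset (critical_independent e) X) :
  diadem e \subset (X :|: neighborhood e X) :\: neighborhood e (ker e).
Proof.
have [ciX maxX] := maxsetP X_max; have /andP[_ iX] := ciX.
apply/bigcupsP => S ciS; have /andP[cS iS] := ciS.
rewrite subsetD; apply/andP; split; last first.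
  rewrite -setI_eq0 -subset0 -(independent_disjoint_neighborhood iS).
  by rewrite setIS // neighborhoodS // ker_sub_critical.
have sXW : X \subset (X :|: S) :\: neighborhood e X.
  rewrite subsetD subsetUl -setI_eq0.
  by rewrite (independent_disjoint_neighborhood iX) eqxx.
have defW := maxX _ (critical_independent_augment e_sym ciX ciS) sXW.
(* The inclusion amounts to [S :\: N X] being contained in [X], which by maximality equals
   [(X :|: S) :\: N X]. *)
by rewrite setUC -subDset -{2}defW setSD // subsetUr.
Qed.
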